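(* Let $\mathcal H$ be a real Hilbert space, let $\psi\colon\mathcal H\to\,]-\infty,+\infty]$ be proper, lower semicontinuous and convex, and let $\varphi\colon\mathcal H\to\mathbb R$ be convex and Gâteaux differentiable. Suppose that for every $x\in\mathcal H$ and every $M\in\,]0,+\infty[$ there are given constants $\mu_M(x)\in[0,+\infty[$ and $L_M(x)\in[\mu_M(x),+\infty[$ such that, for all $y,z\in B_M(x)$, $$\mu_M(x)\|y-z\|^2\le\langle y-z\mid\nabla\varphi(y)-\nabla\varphi(z)\rangle\le L_M(x)\|y-z\|^2 .$$ Assume that the set $S\subset\mathcal H$ of minimizers of $\psi+\varphi$ over $\mathcal H$ is nonempty. Let $x_0\in\mathcal H$, let $\varepsilon>0$, set $M_0:=\sup_{x^*\in S}\|x^*-x_0\|+\varepsilon$ (assumed finite), and suppose that $\mathcal L_{M_0}:=\sup_{x^*\in S}L_{M_0}(x^* )\in\,]0,+\infty[$. Let $\gamma\in\,]0,2/\mathcal L_{M_0}[$ and define $$(\forall n\in\mathbb N)\quad x_{n+1}=\operatorname{prox}_{\gamma\psi}\big(x_n-\gamma\nabla\varphi(x_n)\big).$$ Then the following hold: (i) There exists $x^*\in S$ such that $(x_n)_{n\in\mathbb N}\subset B_{M_0}(x^* )$ and $x_n$ converges weakly to $x^*$. (ii) Suppose that there exists $x^*\in S$ such that $\mu_{M_0}(x^* )>0$. Then $S=\{x^*\}$, $(x_n)_{n\in\mathbb N}\subset B_{M_0}(x^* )$, and $$(\forall n\in\mathbb N)\quad \|x_n-x^*\|\le\big(\rho_{M_0}(x^*,\gamma)\big)^n\|x_0-x^*\|,$$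 where $\rho_{M_0}(x^*,\gamma):=\max\{|1-\gamma\mu_{M_0}(x^* )|,\,|1-\gamma L_{M_0}(x^* )|\}\in\,]0,1[$.
   Context: $B_M(x)$ denotes the open ball centered at $x$ with radius $M$. For a proper lower semicontinuous convex function $f\colon\mathcal H\to\,]-\infty,+\infty]$, the proximity operator is $\operatorname{prox}_f\colon\mathcal H\to\mathcal H$, $x\mapsto\arg\min_{y\in\mathcal H}\big(f(y)+\tfrac12\|x-y\|^2\big)$ (the unique minimizer).
   Formalization: The claim ρ ∈ ]0,1[ fails when γμ = γL = 1 (e.g. ψ = 0, φ = ‖·‖²/2, μ = L = γ = 1 gives ρ = 0); the formal statement asserts 0 ≤ ρ < 1 always and 0 < ρ in all other cases. *)

(* Defs.v *)
From HB Require Import structures.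
From mathcomp Require Import all_boot all_order all_algebra.
From mathcomp Require Import all_classical all_reals all_analysis.

Set Implicit Arguments.
Unset Strict Implicit.
Unset Printing Implicit Defensive.

Import Order.TTheory GRing.Theory Num.Theory.
Import numFieldNormedType.Exports.

Local Open Scope classical_set_scope.
Local Open Scope ring_scope.

Section ExtendedRealValuedFunctions.
Context {R : realType} {H : normedModType R}.
Implicit Types f : H -> \bar R.

Definition proper_function f :=
  (forall x, f x != -oo%E) /\ (exists x, f x != +oo%E).

(** Meant for functions that never take the value [-oo]: the right-hand side
    then has no indeterminate form. *)
Definition econvex_function f := forall (x y : H) (t : R), 0 < t < 1 ->
  (f (t *: x + (1 - t) *: y)%R <= t%:E * f x + (1 - t)%:E * f y)%E.

Definition argmin f : set H := [set x | forall y, (f x <= f y)%E].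

(** The junk value [0] is returned only if there is no minimizer; if [f] is
    proper, lower semicontinuous and convex on a Hilbert space, there is exactly
    one. *)
Definition prox f (x : H) : H :=
  xget 0 (argmin (fun y => (f y + (2^-1 * `|x - y| ^+ 2)%:E)%E)).

End ExtendedRealValuedFunctions.

Section HilbertSpaces.
Context {R : realType} {H : normedModType R}.

Definition gateaux_differentiable (f : H -> R) (x : H) :=
  exists2 D : {linear H -> R^o}, continuous D & forall v, is_derive x v f (D v).

(** [dot] is positive definite, so there is at most one such vector; on a
    Hilbert space, the Riesz representation theorem provides one whenever [f] is
    Gateaux differentiable at [x]. *)
Definition gradient (dot : {dot H for idfun}) (f : H -> R) (x : H) : H :=
  xget 0 [set g | forall v, 'D_v f x = dot v g].

Definition weakly_cvg (dot : {dot H for idfun}) (u : nat -> H) (l : H) :=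
  forall v, dot (u n) v @[n --> \oo] --> dot l v.

End HilbertSpaces.

(* Main.v *)
Require Import Defs.
From HB Require Import structures.
From mathcomp Require Import all_boot all_order all_algebra.
From mathcomp Require Import all_classical all_reals all_analysis.
From mathcomp Require Import ring lra.

Set Implicit Arguments.
Unset Strict Implicit.
Unset Printing Implicit Defensive.

Import Order.TTheory GRing.Theory Num.Theory.
Import numFieldNormedType.Exports.

Local Open Scope classical_set_scope.
Local Open Scope ring_scope.

(**
  A point [p] minimizes [psi + phi] iff [- grad phi p] is a subgradient of [psi]
  at [p], that is, iff [p] is a fixed point of the forward-backward map. On a ball
  where [grad phi] satisfies the two-sided bound with constants [mu <= L], the
  Baillon-Haddad inequality
  [|d|^2 <= (L - mu) <y - z, d>], [d := grad phi y - grad phi z - mu (y - z)],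
  holds: its classical proof evaluates [phi] at points which may leave the ball,
  but for close [y] and [z] they do not, and the inequality for distant points
  follows by subdividing the segment. Hence the forward step is Lipschitz on the
  ball with constant [max |1 - gamma mu| |1 - gamma L|], the iteration is Fejer
  monotone with respect to [S] and never leaves the balls of radius [M0] around
  the minimizers. Weak convergence is Opial's argument, with limits along
  ultrafilters in place of weakly convergent subsequences: the Riesz theorem
  turns the limit of a bounded family of vectors into a vector.
*)

(** * Inner product identities and minimizers of strongly convex functions *)

Section inner_product.
Context (R : realType) (H : completeNormedModType R) (dot : {dot H for idfun}).
Context (normE : forall u : H, `|u| ^+ 2 = dot u u).

Lemma dotC u v : dot u v = dot v u.
Proof. by rewrite hermC expr0 mul1r. Qed.

Lemma dotDl w u v : dot (u + v) w = dot u w + dot v w.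
Proof. by rewrite linearDl. Qed.

Lemma dotDr w u v : dot w (u + v) = dot w u + dot w v.
Proof. by rewrite linearDr. Qed.

Lemma dotNl w u : dot (- u) w = - dot u w.
Proof. by rewrite linearNl. Qed.

Lemma dotNr w u : dot w (- u) = - dot w u.
Proof. by rewrite linearNr. Qed.

Lemma dotZl a w u : dot (a *: u) w = a * dot u w.
Proof. by rewrite linearZl_LR. Qed.

Lemma dotZr a w u : dot w (a *: u) = a * dot w u.
Proof. by rewrite linearZr_LR. Qed.

Definition dotE := (dotDl, dotDr, dotNl, dotNr, dotZl, dotZr).

Lemma dot_ge0 u : 0 <= dot u u.
Proof. by rewrite -normE exprn_ge0. Qed.

Lemma dot_eq0 u : (dot u u == 0) = (u == 0).
Proof. by rewrite -normE sqrf_eq0 normr_eq0. Qed.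

Lemma cauchy_schwarz u v : `|dot u v| <= `|u| * `|v|.
Proof.
have [->|v0] := eqVneq v 0.
  by rewrite linear0r !normr0 mulr0.
have vv0 : 0 < dot v v by rewrite lt_def dot_eq0 v0 dot_ge0.
rewrite -(@ler_pXn2r _ 2) ?nnegrE ?mulr_ge0// exprMn !normE real_normK ?num_real//.
have := dot_ge0 (dot v v *: u - dot u v *: v).
rewrite !dotE (dotC v u) => h.
have : 0 <= dot v v * (dot u u * dot v v - dot u v ^+ 2) by lra.
by rewrite pmulr_rge0// subr_ge0.
Qed.

Lemma lower_semicontinuousD (f : H -> \bar R) (g : H -> R) : lower_semicontinuous f ->
  continuous g -> lower_semicontinuous (fun y => (f y + (g y)%:E)%E).
Proof.
move=> lf cg y a.
rewrite -lteBlDr// -EFinB => h.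
have [b abE bf] : exists2 b, a - g y < b & (b%:E < f y)%E.
  case: (f y) h => [r| |]; rewrite ?lte_fin.
  - by move=> h; exists ((a - g y + r) / 2); rewrite ?lte_fin; lra.
  - by move=> _; exists (a - g y + 1); rewrite ?ltry//; lra.
  - by rewrite ltNge leNye.
have [V Vy hV] := lf _ _ bf.
have : \forall z \near y, a - b < g z by apply: (cvgr_gt _ (cg y)); lra.
move=> near_g; exists (V `&` [set z | a - b < g z]); first exact: filterI.
move=> z [/hV bz /= gz]; rewrite -lteBlDr// -EFinB (le_lt_trans _ bz)// lee_fin; lra.
Qed.

(** A minimizing sequence is Cauchy, since the midpoint of two distant near-minimizers would fall
    below the infimum; lower semicontinuity then bounds [F] at its limit. Real upper bounds [a], [b]
    keep the midpoint condition free of arithmetic with [+oo]. *)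
Lemma strongly_convex_argmin (F : H -> \bar R) (m0 : R) :
  lower_semicontinuous F ->
  (exists y, F y != +oo%E) ->
  (forall y, (m0%:E <= F y)%E) ->
  (forall y z a b, (F y <= a%:E)%E -> (F z <= b%:E)%E ->
    (F (2^-1 *: (y + z)) <= ((a + b) / 2 - `|y - z| ^+ 2 / 8)%:E)%E) ->
  argmin F !=set0.
Proof.
move=> lF [y0 Fy0] bF cF.
pose A := [set a | exists y, (F y <= a%:E)%E].
have hA : has_inf A.
  split; last first.
    by exists m0 => a [y Fya]; rewrite -lee_fin (le_trans (bF y)).
  have := bF y0; move: Fy0; case E : (F y0) => [r| |]// _ _.
  by exists r, y0; rewrite E.
pose m := inf A.
have mF y a : (F y <= a%:E)%E -> m <= a.
  by move=> Fya; apply: ge_inf; [exact: hA.2|exists y].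
have /choice [u uP] (n : nat) : exists y, (F y <= (m + n.+1%:R^-1)%:E)%E.
  have [|a [y Fy] am] := @inf_adherent _ A n.+1%:R^-1 _ hA; first by rewrite invr_gt0.
  by exists y; rewrite (le_trans Fy)// lee_fin ltW.
have ucau n k : `|u n - u k| ^+ 2 <= 4 * (n.+1%:R^-1 + k.+1%:R^-1).
  have /mF := cF _ _ _ _ (uP n) (uP k).
  by move: n.+1%:R^-1 k.+1%:R^-1 (`|_| ^+ 2) => a b c; lra.
have : cvg (u @ \oo).
  apply: cauchy_cvg; apply: cauchy_exP => e e0.
  have e2 : 0 < e ^+ 2 / 8 by rewrite divr_gt0// exprn_gt0.
  have : \forall n \near \oo, n.+1%:R^-1 < e ^+ 2 / 8 :> R.
    exact: (cvgr_lt _ (@cvg_harmonic R)).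
  move=> [N _ hN]; exists (u N); exists N => // n /= Nn.
  rewrite -ball_normE /= -(@ltr_pXn2r _ 2) ?nnegrE ?(ltW e0)//.
  apply: le_lt_trans (ucau N n) _.
  have := hN _ Nn; have := hN N (leqnn N); rewrite /=.
  by move: n.+1%:R^-1 N.+1%:R^-1 (e ^+ 2) => a b c; lra.
move/cvg_ex => [l ul].
have Fl : (F l <= m%:E)%E.
  rewrite leNgt; apply/negP => h.
  have [b mb bF'] : exists2 b, m < b & (b%:E < F l)%E.
    case: (F l) h => [r| |]; rewrite ?lte_fin.
    - by move=> h; exists ((m + r) / 2); rewrite ?lte_fin; lra.
    - by move=> _; exists (m + 1); rewrite ?ltry//; lra.
    - by rewrite ltNge leNye.
  have [V Vl hV] := lF _ _ bF'.
  have h1 : \forall n \near \oo, V (u n) by exact: ul.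
  have h2 : \forall n \near \oo, n.+1%:R^-1 < b - m :> R.
    by apply: (cvgr_lt _ (@cvg_harmonic R)); lra.
  have [n [/hV + h2n]] := filter_ex (filterI h1 h2).
  move=> /lt_le_trans/(_ (uP n)); rewrite lte_fin /=.
  by move: h2n => /=; move: n.+1%:R^-1 => a; lra.
exists l => z; apply: le_trans Fl _.
case E : (F z) => [r| |]; rewrite ?leey//.
  by rewrite lee_fin; apply: (mF z); rewrite E.
by have := bF z; rewrite E.
Qed.

(** This replaces the limit [t -> 0] in optimality inequalities divided by [t]: if [c < 0], the
    value [t = - c / (2 (|d| - c))] violates the hypothesis. *)
Lemma ge0_of_affine_ge0 (c d : R) : (forall t, 0 < t < 1 -> 0 <= c + t * d) -> 0 <= c.
Proof.
move=> h; rewrite leNgt; apply/negP => c0.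
have ad := ler_norm d; have ad0 := normr_ge0 d.
pose K := 2 * (`|d| - c); have K0 : 0 < K by rewrite /K; lra.
pose t := - c / K; have tK : t * K = - c by rewrite divfK ?gt_eqF.
have t0 : 0 < t by rewrite divr_gt0//; lra.
have : 0 < t < 1 by rewrite t0/= -(ltr_pM2r K0) tK mul1r /K; lra.
move=> /h; rewrite leNgt => /negP; apply.
have : t * d <= t * `|d| by rewrite ler_pM2l.
have : t * (2 * (`|d| - c)) = - c by [].
nra.
Qed.

Section proximal.
Context (f : H -> \bar R) (pf : proper_function f) (lf : lower_semicontinuous f)
  (cf : econvex_function f).

Lemma econvex_le y z (a b t : R) : 0 < t < 1 -> (f y <= a%:E)%E -> (f z <= b%:E)%E ->
  (f (t *: y + (1 - t) *: z)%R <= (t * a + (1 - t) * b)%:E)%E.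
Proof.
move=> t01 fy fz; apply: le_trans (cf _ _ t01) _.
by rewrite [leRHS]EFinD 2!EFinM leeD// lee_pmul2l// ?lte_fin; lra.
Qed.

(** The parallelogram law for the quadratic term gives the midpoint gain [|y - z|^2 / 8]. The lower
    bound is supplied by a bounded linear functional in one use and by a known subgradient in the
    other. *)
Lemma argmin_prox_neq0 x :
  (exists m : R, forall y, (m%:E <= f y + (2^-1 * `|x - y| ^+ 2)%:E)%E) ->
  argmin (fun y => (f y + (2^-1 * `|x - y| ^+ 2)%:E)%E) !=set0.
Proof.
move=> [m hm]; apply: (strongly_convex_argmin (m0 := m)) => //.
- apply: lower_semicontinuousD => // y; apply: cvgM; first exact: cvg_cst.
  have xB : `|x - z| @[z --> y] --> `|x - y|.
    by apply: cvg_norm; apply: cvgB; [exact: cvg_cst|exact: cvg_id].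
  exact: (cvgM xB xB).
- by have [y fy] := pf.2; exists y; case: (f y) fy.
- move=> y z a b; rewrite -!leeBrDr// -!EFinB => fy fz.
  have half01 : 0 < (2^-1 : R) < 1 by lra.
  have := econvex_le half01 fy fz.
  rewrite (_ : 1 - 2^-1 = 2^-1); last lra.
  rewrite -scalerDr => /le_trans; apply.
  rewrite lee_fin.
  rewrite !normE !dotE (dotC y x) (dotC z x) (dotC z y); lra.
Qed.

(** First-order optimality: compare [p] with the points of the segment from [p] to [y], divide by
    the parameter and let it tend to 0. *)
Lemma argmin_prox_subgradient x p :
  argmin (fun y => (f y + (2^-1 * `|x - y| ^+ 2)%:E)%E) p ->
  f p \is a fin_num /\ (forall y, (f p + (dot (y - p) (x - p))%:E <= f y)%E).
Proof.
move=> hp.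
have fin_p : f p \is a fin_num.
  rewrite fin_numE pf.1 /=; apply/eqP => fp.
  have [y fy] := pf.2; have := hp y; rewrite fp /=.
  by have := pf.1 y; case: (f y) fy => //.
split=> // y.
have [r fpr] : exists r, f p = r%:E by exists (fine (f p)); rewrite fineK.
have := pf.1 y; case E : (f y) => [b| |]// _; last by rewrite leey.
rewrite fpr -EFinD lee_fin -subr_ge0.
apply: (@ge0_of_affine_ge0 _ (`|y - p| ^+ 2 / 2)) => t t01.
have ty : (f (t *: y + (1 - t) *: p)%R <= (t * b + (1 - t) * r)%:E)%E.
  by apply: econvex_le; rewrite ?E ?fpr.
have := le_trans (hp _) (leeD2r (2^-1 * `|x - (t *: y + (1 - t) *: p)| ^+ 2)%:E ty).
rewrite fpr -!EFinD lee_fin !normE.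
rewrite !dotE (dotC y x) (dotC p x) (dotC p y).
move=> h; have t0 : 0 < t by lra.
rewrite -(pmulr_rge0 _ t0); lra.
Qed.

End proximal.

End inner_product.

(** * Riesz representation, gradients and restriction to lines *)

Section representation.
Context (R : realType) (H : completeNormedModType R) (dot : {dot H for idfun}).
Context (normE : forall u : H, `|u| ^+ 2 = dot u u).
Let dotC := @dotC R H dot.
Let dotE := @dotE R H dot.

(* The representing vector minimizes [|v|^2 / 2 - D v]. *)
Lemma riesz_representation (D : H -> R) (C : R) :
  (forall a u v, D (a *: u + v) = a * D u + D v) ->
  (forall v, `|D v| <= C * `|v|) -> exists p, forall v, D v = dot v p.
Proof.
move=> linD bD.
have D0 : D 0 = 0 by have := linD 1 0 0; rewrite scaler0 addr0 mul1r; lra.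
have DZ a u : D (a *: u) = a * D u by have := linD a u 0; rewrite !addr0 D0 addr0.
have DD u v : D (u + v) = D u + D v by have := linD 1 u v; rewrite scale1r mul1r.
have DN u : D (- u) = - D u by rewrite -scaleN1r DZ mulN1r.
have cD : continuous D.
  move=> x; apply/cvgrPdist_lt => e e0.
  have C1 : 0 < `|C| + 1 by rewrite ltr_wpDl.
  have : \forall y \near x, `|x - y| < e / (`|C| + 1).
    by apply: cvgr_dist_lt; rewrite ?divr_gt0.
  apply: filterS => y; rewrite ltr_pdivlMr// => h.
  rewrite -DN -DD (le_lt_trans (bD _))// (le_lt_trans _ h)// mulrC ler_wpM2l//.
  by have := ler_norm C; lra.
pose f y := (- D y)%:E.
have pf : proper_function f by split=> [//|]; exists 0.
have lf : lower_semicontinuous f.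
  have -> : f = fun y => (0%:E + (- D y)%:E)%E by apply/funext => y; rewrite add0e.
  apply: (@lower_semicontinuousD _ _ (cst 0%:E)) => [y a /= a0|y]; last first.
    by apply: (@cvgN _ R^o); exact: cD.
  by exists setT; first exact: filterT.
have cf : econvex_function f.
  by move=> x y t t01; rewrite /f -!EFinM -EFinD lee_fin DD !DZ; lra.
have [p hp] : argmin (fun y => (f y + (2^-1 * `|0 - y| ^+ 2)%:E)%E) !=set0.
  apply: (argmin_prox_neq0 normE pf lf cf); exists (- (C ^+ 2) / 2) => y.
  rewrite /f -EFinD lee_fin sub0r normrN.
  have := bD y; rewrite ler_norml => /andP[_ h].
  have := sqr_ge0 (C - `|y|); nra.
have [_ vp] := argmin_prox_subgradient normE pf cf hp.
exists p => v.
(* The subgradient inequality in the opposite directions [v] and [- v] forces equality. *)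
have := vp (p + v); have := vp (p - v).
rewrite /f -!EFinD !lee_fin !dotE linear0r !DD !DN.
lra.
Qed.

(** The Riesz vector of the Gateaux derivative shows that the set from which [gradient] chooses is
    nonempty, so the default value 0 is not taken by accident. *)
Lemma gradient_is_derive (phi : H -> R) x v : gateaux_differentiable phi x ->
  is_derive x v phi (dot v (gradient dot phi x)).
Proof.
move=> [D cD hD].
have [C bD] : exists C, forall v, `|D v| <= C * `|v|.
  have /linear_boundedP := continuous_linear_bounded 0 (cD 0).
  by move=> /pinfty_ex_gt0[C _ hC]; exists C.
have [p hp] : exists p, forall v, D v = dot v p.
  by apply: (riesz_representation (C := C)) => // a u w; rewrite linearP.
have /(_ v) <- : forall w, 'D_w phi x = dot w (gradient dot phi x).
  rewrite /gradient; case: xgetP => [g _ //|/(_ p)]; apply: contra_notP => _ w.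
  by have [_ ->] := hD w; rewrite hp.
by have := hD v => dv; apply: DeriveDef.
Qed.

Lemma is_derive_line (phi : H -> R) y v (t : R) :
  gateaux_differentiable phi (y + t *: v) ->
  is_derive t 1 (fun s => phi (y + s *: v))
    (dot v (gradient dot phi (y + t *: v))).
Proof.
move=> /(@gradient_is_derive _ _ v)[d1 d2].
have eq_quotient : (fun h : R =>
    h^-1 *: ((fun s => phi (y + s *: v)) (h *: 1 + t) - phi (y + t *: v))) =
  fun h : R => h^-1 *: ((phi \o shift (y + t *: v)) (h *: v) - phi (y + t *: v)).
  apply/funext => h /=; congr (_ *: (phi _ - _)).
  by rewrite [h *: 1]mulr1 scalerDl addrCA.
by split; rewrite /derivable /derive /= ?[X in X @ _]eq_quotient.
Qed.

(** This stands in for integrating [k'] over the unit interval: subtracting [c t + m t^2 / 2] turns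
    a bound on [k' t - c] by [m t] into a bound on [k 1 - k 0 - c] by [m / 2]. *)
Lemma mean_value_quadratic (k k' : R -> R) (c m : R) :
  (forall t : R, is_derive t 1 k (k' t)) ->
  exists2 t, 0 < t < 1 & k 1 - k 0 - (c + m / 2) = k' t - (c + t * m).
Proof.
move=> dk.
pose w := fun t => k t - (c * t + m / 2 * (t * t)).
have dw (t : R) : is_derive t 1 w (k' t - (c + t * m)).
  by apply: is_derive_eq; rewrite /GRing.scale/=; lra.
have [|t] := @MVT _ w (fun t => k' t - (c + t * m)) 0 1 ltr01 (fun t _ => dw t).
  apply: continuous_subspaceT => t.
  by apply/differentiable_continuous/derivable1_diffP; case: (dw t).
by rewrite in_itv/= => t01; rewrite /w => e; exists t => //; lra.
Qed.

End representation.

(** * Local Baillon-Haddad inequality and the forward step *)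

Section local_cocoercivity.
Context (R : realType) (H : completeNormedModType R) (dot : {dot H for idfun}).
Context (normE : forall u : H, `|u| ^+ 2 = dot u u).
Let dotC := @dotC R H dot.
Let dotE := @dotE R H dot.

Lemma norm_segment_le (c y v : H) (t r : R) : 0 <= t <= 1 ->
  `|c - y| <= r -> `|c - (y + v)| <= r -> `|c - (y + t *: v)| <= r.
Proof.
move=> /andP[t0 t1]; rewrite !opprD !addrA; move: (c - y) => a ha hb.
have -> : a - t *: v = (1 - t) *: a + t *: (a - v).
  by rewrite scalerBl scale1r scalerBr addrA subrK.
rewrite (le_trans (ler_normD _ _))// !normrZ !ger0_norm ?subr_ge0//; nra.
Qed.

(** Because the ball is open, a margin [M - r > 0] remains around the two points, and by convexity
    around their whole segment. *)
Lemma norm_max_ball (c y z : H) (M : R) : ball c M y -> ball c M z ->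
  exists2 r, r < M & `|c - y| <= r /\ `|c - z| <= r.
Proof.
rewrite -ball_normE /= => hy hz; exists (Num.max `|c - y| `|c - z|).
  by rewrite gt_max hy.
by rewrite !le_max !lexx orbT.
Qed.

Lemma ball_segment (c y v : H) (M t : R) : 0 <= t <= 1 ->
  ball c M y -> ball c M (y + v) -> ball c M (y + t *: v).
Proof.
move=> t01 hy /(norm_max_ball hy)[r rM [h1 h2]].
by rewrite -ball_normE /= (le_lt_trans _ rM)// norm_segment_le.
Qed.

(** Expanding [|A - k B|^2 >= 0] gives the claim. It is the induction step of the subdivision: [A]
    is the sum of [k] increments and [B] the next one. *)
Lemma sqr_norm_add_le (A B : H) (k X Y : R) : 0 < k ->
  `|A| ^+ 2 <= k * X -> `|B| ^+ 2 <= Y ->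
  `|A + B| ^+ 2 <= (k + 1) * (X + Y).
Proof.
move=> k0 hA hB; rewrite -subr_ge0 -(pmulr_rge0 _ k0).
have h := dot_ge0 normE (A - k *: B).
have : 0 <= (k + 1) * (k * X - dot A A) by rewrite mulr_ge0 -?normE ?subr_ge0//; lra.
have : 0 <= (k + 1) * k * (Y - dot B B) by rewrite !mulr_ge0 -?normE ?subr_ge0//; lra.
by move: h; rewrite normE !dotE (dotC B A); lra.
Qed.

Section local_smoothness.
Context (phi : H -> R) (phi_gateaux : forall u : H, gateaux_differentiable phi u).
Local Notation g := (gradient dot phi).
Context (c : H) (M mu L : R) (muL : mu <= L).
Context (grad_bounds : forall y z : H, ball c M y -> ball c M z ->
  mu * `|y - z| ^+ 2 <= dot (y - z) (g y - g z) <= L * `|y - z| ^+ 2).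

(** The segment stays in the ball, so the slope of [phi] at parameter [t] exceeds its initial value
    by between [mu t |v|^2] and [L t |v|^2]; the mean value theorem does the rest. *)
Lemma quadratic_bounds y w : ball c M y -> ball c M w ->
  mu / 2 * `|w - y| ^+ 2 <= phi w - phi y - dot (w - y) (g y)
    <= L / 2 * `|w - y| ^+ 2.
Proof.
move=> yM; have -> : w = y + (w - y) by rewrite addrC subrK.
move: (w - y) => v yvM; rewrite [y + v - y]addrAC subrr add0r.
have dk (t : R) := is_derive_line normE (phi_gateaux (y + t *: v)).
have slope t : 0 < t < 1 ->
    mu * t * `|v| ^+ 2 <= dot v (g (y + t *: v)) - dot v (g y) <= L * t * `|v| ^+ 2.
  move=> /andP[t0 t1]; have t01 : 0 <= t <= 1 by rewrite !ltW.
  have := grad_bounds (ball_segment t01 yM yvM) yM.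
  rewrite addrAC subrr add0r normrZ exprMn real_normK ?num_real//.
  move: (g (y + t *: v)) (g y) => G' G; rewrite !dotE.
  by move=> /andP[h1 h2]; apply/andP; split; rewrite -(ler_pM2l t0); lra.
have [t1 t101] := mean_value_quadratic (dot v (g y)) (mu * `|v| ^+ 2) dk.
have [t2 t201] := mean_value_quadratic (dot v (g y)) (L * `|v| ^+ 2) dk.
have /andP[h1 _] := slope _ t101; have /andP[_ h2] := slope _ t201.
move: h1 h2; rewrite /= scale1r scale0r addr0.
move: (g (y + t1 *: v)) (g (y + t2 *: v)) (g y) => G1 G2 G h1 h2 e2 e1.
by apply/andP; split; lra.
Qed.

(** [d] is the gradient increment of [phi - mu / 2 |.|^2], whose gradient satisfies the bounds 0 and
    [L - mu]. The two balls of radius [r] keep the test points of the Baillon-Haddad argument inside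
    the domain. *)
Lemma shifted_cocoercive_near y z d r : ball y r `<=` ball c M -> ball z r `<=` ball c M ->
  `|y - z| < r -> d = g y - g z - mu *: (y - z) ->
  `|d| ^+ 2 <= (L - mu) * dot (y - z) d.
Proof.
move=> yr zr yzr dE.
have r0 : 0 < r by rewrite (le_lt_trans _ yzr).
(* Compare [phi] from above and below at the test points [z + s d] and [y - s d]. *)
have key (s : R) : 0 <= s -> s * `|d| < r ->
    (2 * s - (L - mu) * s ^+ 2) * `|d| ^+ 2 <= dot (y - z) d.
  move=> s0 sr.
  have yM : ball c M y by apply/yr/ballxx.
  have zM : ball c M z by apply/zr/ballxx.
  have wM : ball c M (z + s *: d).
    by apply: zr; rewrite -ball_normE /= opprD addNKr normrN normrZ ger0_norm.
  have wM' : ball c M (y - s *: d).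
    by apply: yr; rewrite -ball_normE /= opprB addrC subrK normrZ ger0_norm.
  have /andP[_ h1] := quadratic_bounds zM wM.
  have /andP[_ h2] := quadratic_bounds yM wM'.
  have /andP[h3 _] := quadratic_bounds yM wM.
  have /andP[h4 _] := quadratic_bounds zM wM'.
  move: h1 h2 h3 h4 dE; move: (g y) (g z) => gy gz h1 h2 h3 h4 dE.
  have dd : dot d d = dot d gy - dot d gz - mu * (dot d y - dot d z).
    by rewrite {2}dE !dotE; lra.
  have yd : dot y d = dot y gy - dot y gz - mu * (dot y y - dot y z).
    by rewrite {1}dE !dotE; lra.
  have zd : dot z d = dot z gy - dot z gz - mu * (dot y z - dot z z).
    by rewrite {1}dE !dotE (dotC z y); lra.
  move: h1 h2 h3 h4; rewrite !normE !dotE (dotC d y) (dotC d z) (dotC z y).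
  have sdd : s * dot d d = s * (dot d gy - dot d gz - mu * (dot y d - dot z d)).
    by rewrite dd (dotC d y) (dotC d z).
  lra.
have [d0|d0] := eqVneq d 0; first by rewrite d0 linear0r normr0 expr0n/= mulr0.
have nd0 : 0 < `|d| by rewrite normr_gt0.
have cs := le_trans (ler_norm _) (cauchy_schwarz normE (y - z) d).
(* If [|d| < (L - mu) r], the classical step [s = 1 / (L - mu)], which maximizes the factor in
   [key], is admissible. *)
have [dr|rd] := ltP `|d| ((L - mu) * r).
  have l0 : 0 < L - mu by rewrite -(pmulr_lgt0 _ r0) (lt_trans nd0).
  have /key : 0 <= (L - mu)^-1 by rewrite invr_ge0 ltW.
  rewrite mulrC ltr_pdivrMr// (mulrC r) => /(_ dr).
  rewrite -(ler_pM2l l0); congr (_ <= _).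
  by field; rewrite gt_eqF.
(* If [|d| >= (L - mu) r], then [s |d| = rho > |y - z|] contradicts Cauchy-Schwarz. *)
pose rho := (`|y - z| + r) / 2.
have rho0 : 0 < rho by have := normr_ge0 (y - z); rewrite /rho; lra.
have rhor : rho < r by rewrite /rho; lra.
have rd' : (L - mu) * rho <= `|d|.
  by apply: le_trans rd; rewrite ler_wpM2l ?subr_ge0// ltW.
have := key _ (ltW (divr_gt0 rho0 nd0)); rewrite divfK ?gt_eqF// => /(_ rhor).
have -> : (2 * (rho / `|d|) - (L - mu) * (rho / `|d|) ^+ 2) * `|d| ^+ 2 =
    2 * rho * `|d| - (L - mu) * rho * rho.
  by field; rewrite gt_eqF.
have : (L - mu) * rho * rho <= `|d| * rho by rewrite ler_wpM2r// ltW.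
have : `|y - z| * `|d| < rho * `|d| by rewrite ltr_pM2r// /rho; lra.
lra.
Qed.

Lemma shifted_cocoercive y z d : ball c M y -> ball c M z ->
  d = g y - g z - mu *: (y - z) ->
  `|d| ^+ 2 <= (L - mu) * dot (y - z) d.
Proof.
move=> yM zM ->; have [r rM [zr yr]] := norm_max_ball zM yM.
pose D u := g u - mu *: u.
have -> : g y - g z - mu *: (y - z) = D y - D z.
  by rewrite /D scalerBr !opprD !opprK !addrA; congr (_ + _); rewrite addrAC.
pose e := y - z.
(* The number of pieces is chosen so that each is shorter than the margin [M - r]. *)
have [N hN] : exists N : nat, `|e| < N.+1%:R * (M - r).
  have Mr : 0 < M - r by rewrite subr_gt0.
  exists (Num.truncn (`|e| / (M - r))); rewrite -ltr_pdivrMr//.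
  exact: truncnS_gt.
pose n := N.+1; have n0 : 0 < (n%:R : R) by rewrite ltr0n.
pose p (k : nat) := z + (k%:R / n%:R) *: e.
have p_near k : (k <= n)%N -> ball (p k) (M - r) `<=` ball c M.
  move=> kn w; rewrite -!ball_normE /= => hw.
  have : `|c - p k| <= r.
    apply: norm_segment_le => //; last by rewrite /e [z + _]addrC subrK.
    by rewrite divr_ge0//= ler_pdivrMr// mul1r ler_nat.
  have -> : c - w = (c - p k) + (p k - w) by rewrite addrA subrK.
  have := ler_normD (c - p k) (p k - w); lra.
have step k : p k.+1 - p k = n%:R^-1 *: e.
  by rewrite /p opprD addrACA subrr add0r -scalerBl -mulrBl -natr1 addrAC subrr add0r mul1r.
(* The factor grows linearly in [k], so the [n] pieces lose nothing: at [k = n] the constant is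
   again [L - mu]. *)
have chain k : (k <= n)%N ->
    `|D (p k) - D z| ^+ 2 <= k%:R * ((L - mu) / n%:R * dot e (D (p k) - D z)).
  elim: k => [_|k IH kn].
    by rewrite /p mul0r scale0r addr0 subrr normr0 expr0n mul0r.
  have hk : `|D (p k.+1) - D (p k)| ^+ 2 <= (L - mu) / n%:R * dot e (D (p k.+1) - D (p k)).
    have := shifted_cocoercive_near (p_near _ kn) (p_near _ (ltnW kn)) _ erefl.
    have -> : g (p k.+1) - g (p k) - mu *: (p k.+1 - p k) = D (p k.+1) - D (p k).
      by rewrite /D scalerBr !opprD !opprK !addrA; congr (_ + _); rewrite addrAC.
    rewrite step dotZl mulrA; apply.
    by rewrite normrZ gtr0_norm ?invr_gt0// mulrC ltr_pdivrMr// mulrC.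
  have -> : D (p k.+1) - D z = (D (p k) - D z) + (D (p k.+1) - D (p k)).
    by rewrite [RHS]addrC addrA subrK.
  rewrite [dot e (_ + _)]linearDr mulrDr -natr1.
  (* The first piece is separate because [sqr_norm_add_le] requires a positive weight. *)
  case: k IH kn hk => [|k] IH kn hk.
    have -> : p 0 = z by rewrite /p mul0r scale0r addr0.
    rewrite subrr linear0r mulr0 !add0r mul1r.
    by move: hk; rewrite [p 0](_ : _ = z) // /p mul0r scale0r addr0.
  by apply: sqr_norm_add_le => //; [exact: IH (ltnW kn)].
have := chain n (leqnn n).
have -> : p n = y by rewrite /p divff ?gt_eqF// scale1r /e addrC subrK.
by rewrite mulrA [_ * (_ / _)]mulrC divfK ?gt_eqF.
Qed.

(** Expanding the square removes the shift by [mu]. For [mu = 0] this is cocoercivity of the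
    gradient. *)
Lemma gradient_bounds_combined y z : ball c M y -> ball c M z ->
  `|g y - g z| ^+ 2 + mu * L * `|y - z| ^+ 2 <= (mu + L) * dot (y - z) (g y - g z).
Proof.
move=> yM zM; have := shifted_cocoercive yM zM erefl.
move: (g y - g z) (y - z) => G e; rewrite !normE !dotE (dotC G e); lra.
Qed.

Lemma forward_step_lipschitz gam y z : 0 <= gam -> ball c M y -> ball c M z ->
  `|(y - gam *: g y) - (z - gam *: g z)| <=
    Num.max `|1 - gam * mu| `|1 - gam * L| * `|y - z|.
Proof.
move=> gam0 yM zM; set rho := Num.max _ _.
have rho0 : 0 <= rho by rewrite le_max normr_ge0.
rewrite -(@ler_pXn2r _ 2) ?nnegrE ?mulr_ge0// exprMn.
have rmu : (1 - gam * mu) ^+ 2 <= rho ^+ 2.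
  by rewrite -[leLHS]real_normK ?num_real// ler_pXn2r ?nnegrE// le_max lexx.
have rL : (1 - gam * L) ^+ 2 <= rho ^+ 2.
  by rewrite -[leLHS]real_normK ?num_real// ler_pXn2r ?nnegrE// le_max lexx orbT.
have -> : y - gam *: g y - (z - gam *: g z) = (y - z) - gam *: (g y - g z).
  by rewrite scalerBr !opprD !opprK !addrA; congr (_ + _); rewrite addrAC.
have := gradient_bounds_combined yM zM; have := grad_bounds yM zM.
move: (g y - g z) (y - z) => G e.
rewrite !normE !dotE (dotC G e) => /andP[h1 h2] h3.
have e0 := dot_ge0 normE e.
have h4 : gam ^+ 2 * (dot G G + mu * L * dot e e) <= gam ^+ 2 * ((mu + L) * dot e G).
  by rewrite ler_wpM2l// exprn_ge0.
(* After [h3] the bound is affine in [dot e G], so it is largest at one end of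
   [[mu |e|^2, L |e|^2]]; the sign of [2 - gam (mu + L)] decides which. *)
have [h5|h5] := leP (gam * (mu + L)) 2.
  have : gam * (2 - gam * (mu + L)) * (dot e G - mu * dot e e) >= 0.
    by rewrite !mulr_ge0// subr_ge0.
  have : (1 - gam * mu) ^+ 2 * dot e e <= rho ^+ 2 * dot e e by rewrite ler_wpM2r.
  lra.
have : gam * (gam * (mu + L) - 2) * (L * dot e e - dot e G) >= 0.
  by rewrite !mulr_ge0// subr_ge0// ltW.
have : (1 - gam * L) ^+ 2 * dot e e <= rho ^+ 2 * dot e e by rewrite ler_wpM2r.
lra.
Qed.

End local_smoothness.
End local_cocoercivity.

(** * Subgradients, the proximity operator and minimizers of [psi + phi] *)

Section subgradients.
Context (R : realType) (H : completeNormedModType R) (dot : {dot H for idfun}).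
Context (normE : forall u : H, `|u| ^+ 2 = dot u u).
Let dotC := @dotC R H dot.
Let dotE := @dotE R H dot.

Definition subgradient (f : H -> \bar R) (p q : H) :=
  f p \is a fin_num /\ forall y, (f p + (dot (y - p) q)%:E <= f y)%E.

Lemma subgradient_monotone f p q p' q' :
  subgradient f p q -> subgradient f p' q' -> 0 <= dot (p - p') (q - q').
Proof.
move=> [fp /(_ p')] + [fp' /(_ p)].
move: fp fp'; case: (f p) => // a; case: (f p') => // b _ _.
rewrite -!EFinD !lee_fin !dotE; lra.
Qed.

Section convex_psi.
Context (psi : H -> \bar R) (psi_proper : proper_function psi)
    (psi_lsc : lower_semicontinuous psi) (psi_convex : econvex_function psi).

Lemma scale_proper gam : 0 < gam -> proper_function (fun u => (gam%:E * psi u)%E).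
Proof.
move=> g0; split=> [x|].
  by have := psi_proper.1 x; case: (psi x) => // _; rewrite gt0_muley.
have [x px] := psi_proper.2; exists x; have := psi_proper.1 x.
by case: (psi x) px.
Qed.

Lemma scale_lsc gam : 0 < gam -> lower_semicontinuous (fun u => (gam%:E * psi u)%E).
Proof.
move=> g0 x a; rewrite -lte_pdivrMl// -EFinM => /psi_lsc[V Vx hV].
by exists V => // y /hV; rewrite EFinM lte_pdivrMl.
Qed.

Lemma scale_convex gam : 0 < gam -> econvex_function (fun u => (gam%:E * psi u)%E).
Proof.
move=> g0 x y t t01; rewrite muleCA [X in (_ <= _ + X)%E]muleCA -muleDr//.
  by rewrite lee_pmul2l ?lte_fin//; exact: psi_convex.
have /andP[t0 t1] := t01.
rewrite /adde_def.
have := psi_proper.1 x; have := psi_proper.1 y.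
case: (psi x) => [r| |]//; case: (psi y) => [r'| |]// _ _;
  rewrite ?gt0_muley ?lte_fin ?subr_gt0//.
Qed.

(** Once a minimizer exists, [prox] is not the default value, and its optimality condition makes it
    the resolvent of the subdifferential of [psi]. *)
Lemma prox_subgradient gam p0 q0 u : 0 < gam -> subgradient psi p0 q0 ->
  let p := prox (fun y => (gam%:E * psi y)%E) u in
  subgradient psi p (gam^-1 *: (u - p)).
Proof.
move=> g0 [fin0 sub0] p.
(* The affine minorant given by [q0] bounds the objective from below. *)
have [z hz] : argmin (fun y => (gam%:E * psi y + (2^-1 * `|u - y| ^+ 2)%:E)%E) !=set0.
  apply: (argmin_prox_neq0 normE (scale_proper g0) (scale_lsc g0) (scale_convex g0)).
  move: sub0; rewrite -(fineK fin0); set a := fine _ => sub0.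
  (* The minimum over [y] of the affine minorant plus the quadratic term, attained at
     [u - gam q0]. *)
  exists (gam * a + gam * dot (u - p0) q0 - gam ^+ 2 / 2 * dot q0 q0) => y.
  have := sub0 y; rewrite -EFinD -(lee_pmul2l _ (_ : (0 < gam%:E)%E))//.
  move=> /(leeD2r (2^-1 * `|u - y| ^+ 2)%:E).
  apply: le_trans; rewrite -EFinM -EFinD lee_fin.
  have := dot_ge0 normE (y - u + gam *: q0).
  rewrite normE !dotE (dotC q0) (dotC q0 u) (dotC u y); lra.
have : argmin (fun y => (gam%:E * psi y + (2^-1 * `|u - y| ^+ 2)%:E)%E) p.
  by rewrite /p /prox; case: xgetP => [? _ //|/(_ z)].
move=> /(argmin_prox_subgradient normE (scale_proper g0) (scale_convex g0))[fp hp].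
have fin_p : psi p \is a fin_num.
  by move: fp; have := psi_proper.1 p; case: (psi p) => //; rewrite gt0_muley.
split=> // y; rewrite -(lee_pmul2l _ (_ : (0 < gam%:E)%E))//.
by rewrite muleDr ?fin_num_adde_defr// -EFinM dotZr mulVKf ?gt_eqF.
Qed.

Section composite.
Context (phi : H -> R) (phi_gateaux : forall u : H, gateaux_differentiable phi u)
  (mu L : R -> H -> R).
Local Notation g := (gradient dot phi).
Context (mu_ge0 : forall (M : R) (u : H), 0 < M -> 0 <= mu M u).
Context (mu_L_bounds : forall (M : R) (u : H), 0 < M ->
  forall y z : H, ball u M y -> ball u M z ->
  mu M u * `|y - z| ^+ 2 <= dot (y - z) (g y - g z) <= L M u * `|y - z| ^+ 2).

(** Any two points share a ball, so bounds given for every radius apply to any pair. *)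
Let ball_1 (p v : H) : ball p (`|v| + 1) p /\ ball p (`|v| + 1) (p + v).
Proof.
split; first by apply: ballxx; rewrite ltr_wpDl.
by rewrite -ball_normE /= opprD addNKr normrN ltrDl.
Qed.

Lemma gradient_monotone y z : 0 <= dot (y - z) (g y - g z).
Proof.
have [zM yM] := ball_1 z (y - z); move: yM; rewrite [z + _]addrC subrK => yM.
have M0 : 0 < `|y - z| + 1 by rewrite ltr_wpDl.
have /andP[+ _] := mu_L_bounds M0 yM zM; apply: le_trans.
by rewrite mulr_ge0// mu_ge0.
Qed.

(** Moving from [p] towards [y] by [t], the upper quadratic bound leaves a remainder of order [t^2],
    which disappears after division by [t]. *)
Lemma minimizer_subgradient p :
  argmin (fun u => (psi u + (phi u)%:E)%E) p -> subgradient psi p (- g p).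
Proof.
move=> hp.
have fin_p : psi p \is a fin_num.
  rewrite fin_numE psi_proper.1 /=; apply/eqP => fp.
  have [y fy] := psi_proper.2; have := hp y; rewrite fp /=.
  by have := psi_proper.1 y; case: (psi y) fy.
split=> // y.
have [r fpr] : exists r, psi p = r%:E by exists (fine (psi p)); rewrite fineK.
have := psi_proper.1 y; case E : (psi y) => [b| |]// _; last by rewrite leey.
rewrite fpr -EFinD lee_fin -subr_ge0.
pose M := `|y - p| + 1; have M0 : 0 < M by rewrite ltr_wpDl.
have [pM yM] := ball_1 p (y - p).
apply: (@ge0_of_affine_ge0 _ _ (L M p / 2 * `|y - p| ^+ 2)) => t /[dup] t01 /andP[t0 t1].
have t01' : 0 <= t <= 1 by rewrite !ltW.
have tM := ball_segment t01' pM yM.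
have /andP[_] := quadratic_bounds normE phi_gateaux (mu_L_bounds M0) pM tM.
have ty : (psi (t *: y + (1 - t) *: p)%R <= (t * b + (1 - t) * r)%:E)%E.
  by apply: econvex_le => //; rewrite ?E ?fpr.
have e : t *: y + (1 - t) *: p = p + t *: (y - p).
  by rewrite scalerBl scale1r scalerBr addrCA.
rewrite e in ty.
have := le_trans (hp (p + t *: (y - p))) (leeD2r (phi (p + t *: (y - p)))%:E ty).
rewrite fpr -!EFinD lee_fin [p + _ - p]addrAC subrr add0r.
rewrite normrZ exprMn real_normK ?num_real// linearNr.
rewrite dotZl -(pmulr_rge0 _ t0).
lra.
Qed.

(** As [mu >= 0], [phi] lies above its tangent at [p]; the subgradient inequality of [psi] is added
    to this. *)
Lemma subgradient_minimizer p : subgradient psi p (- g p) ->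
  argmin (fun u => (psi u + (phi u)%:E)%E) p.
Proof.
move=> [fin_p hp] y.
have [pM yM] := ball_1 p (y - p); move: yM; rewrite [p + _]addrC subrK => yM.
have M0 : 0 < `|y - p| + 1 by rewrite ltr_wpDl.
have /andP[+ _] := quadratic_bounds normE phi_gateaux (mu_L_bounds M0) pM yM.
have : 0 <= mu (`|y - p| + 1) p / 2 * `|y - p| ^+ 2.
  by rewrite !mulr_ge0// mu_ge0.
move=> h1 h2; have := hp y; rewrite -(fineK fin_p) linearNr.
case: (psi y) => [b| |]//; rewrite -?EFinD ?lee_fin ?leey//; lra.
Qed.

(* [p'] need not lie in [ball p M]: use strong monotonicity between [p] and a point
   [q] of the segment close to [p], and monotonicity from [q] to [p']. *)
Lemma minimizer_unique p p' M : argmin (fun u => (psi u + (phi u)%:E)%E) p ->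
  argmin (fun u => (psi u + (phi u)%:E)%E) p' -> 0 < M -> 0 < mu M p -> p' = p.
Proof.
move=> /minimizer_subgradient sp /minimizer_subgradient sp' M0 muM.
apply/eqP; rewrite -subr_eq0 -normr_eq0; apply/negPn/negP => e0.
have {}e0 : 0 < `|p' - p| by rewrite lt_def e0 normr_ge0.
(* This choice gives both [t < 1] and [t |p' - p| < M]. *)
pose t := M / (`|p' - p| + M).
have eM0 : 0 < `|p' - p| + M by rewrite addr_gt0.
have t0 : 0 < t by rewrite divr_gt0.
have t1 : t < 1 by rewrite ltr_pdivrMr// mul1r ltrDr.
pose q := p + t *: (p' - p).
have qM : ball p M q.
  rewrite -ball_normE /= /q opprD addNKr normrN normrZ gtr0_norm//.
  by rewrite /t mulrAC ltr_pdivrMr// ltr_pM2l// ltrDl.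
have /andP[+ _] := mu_L_bounds M0 qM (ballxx _ M0).
have := gradient_monotone p' q; have := subgradient_monotone sp' sp.
have -> : q - p = t *: (p' - p) by rewrite /q addrAC subrr add0r.
have -> : p' - q = (1 - t) *: (p' - p).
  by rewrite /q opprD addrA scalerBl scale1r.
rewrite normrZ exprMn real_normK ?num_real// !dotZl.
move: (g p') (g p) (g q) => gp' gp gq; rewrite !(dotDr, dotNr).
have : 0 < mu M p * (t * `|p' - p| ^+ 2).
  by apply: mulr_gt0 => //; apply: mulr_gt0 => //; exact: exprn_gt0.
rewrite pmulr_rge0 ?subr_gt0// => h1 h2 h3 h4.
have : mu M p * (t * `|p' - p| ^+ 2) <= dot (p' - p) gq - dot (p' - p) gp.
  by rewrite -(ler_pM2l t0); lra.
lra.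
Qed.

End composite.
End convex_psi.
End subgradients.

(** * Ultrafilters and weak limits *)

Lemma ultra_cvg_compact (T : Type) (X : topologicalType) (U : set_system T)
    (f : T -> X) (K : set X) : UltraFilter U -> compact K ->
  (forall n, K (f n)) -> exists2 l, K l & f @ U --> l.
Proof.
move=> UU cK fK.
have PU : ProperFilter U by apply: ultra_proper.
have fUK : (f @ U) K.
  by apply: (@filterS _ U _ setT); [move=> n _; exact: fK|exact: filterT].
have [l [Kl fl]] := cK (f @ U) _ fUK.
exists l => // A Al; have [//|UnA] := in_ultra_setVsetC (f @^-1` A) UU.
by have [y []] := fl (~` A) A UnA Al.
Qed.

(** If [A] is not in [F], then [F] restricted to the complement of [A] is proper and extends to an
    ultrafilter avoiding [A]. Thus convergence can be tested along ultrafilters. *)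
Lemma mem_filter_of_ultra (T : Type) (F : set_system T) (A : set T) : Filter F ->
  (forall U, UltraFilter U -> F `<=` U -> U A) -> F A.
Proof.
move=> FF UA; apply: contrapT => nFA.
have PF : ProperFilter (within (~` A) F).
  apply: Build_ProperFilter_ex => B FB; apply: contrapT => nB; apply: nFA.
  move: FB; rewrite /within /=; apply: filterS => n hn; apply: contrapT => nA; apply: nB.
  by exists n; exact: hn.
have [U [UU sU]] := ultraFilterLemma PF.
have /filter_ex[n []//] : U (A `&` ~` A).
have UnA : U (~` A) by apply: (sU (~` A)); rewrite /within /=; exact: filterE.
apply: filterI UnA; apply: UA => // B FB; apply: (sU B).
by rewrite /within /=; apply: filterS FB.
Qed.

Section weak_limits.
Context (R : realType) (H : completeNormedModType R) (dot : {dot H for idfun}).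
Context (normE : forall u : H, `|u| ^+ 2 = dot u u).
Let dotC := @dotC R H dot.
Let dotE := @dotE R H dot.

(** Each scalar family [dot (x n) v] lies in a compact interval and converges along [U]; the limit
    is linear and bounded in [v], hence represented by a vector. *)
Lemma ultra_weak_limit (T : Type) (U : set_system T) (x : T -> H) (C : R) :
  UltraFilter U -> (forall n, `|x n| <= C) ->
  exists w, forall v, dot (x n) v @[n --> U] --> dot w v.
Proof.
move=> UU xC; have PU : ProperFilter U by apply: ultra_proper.
have /choice[l hl] v : exists a : R, dot (x n) v @[n --> U] --> a.
  have [|a _ ha] := @ultra_cvg_compact T R U (fun n => dot (x n) v)
    `[- (C * `|v|), C * `|v|]%classic UU (@segment_compact _ _ _);
    last by exists a.
  move=> n; rewrite /= in_itv/= -ler_norml.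
  by rewrite (le_trans (cauchy_schwarz normE _ _))// ler_wpM2r.
have [||p hp] := @riesz_representation _ _ _ normE l C.
- move=> a u v; apply: (cvg_unique _ (hl _)) => //.
  have -> : (fun n => dot (x n) (a *: u + v)) = (fun n => a * dot (x n) u + dot (x n) v).
    by apply/funext => n; rewrite !dotE.
  by apply: cvgD => //; apply: cvgM => //; exact: cvg_cst.
- move=> v; have lv : `|dot (x n) v| @[n --> U] --> `|l v| by exact: cvg_norm.
  apply: (cvgr_to_le lv); apply: filterE => n.
  by rewrite (le_trans (cauchy_schwarz normE _ _))// ler_wpM2r.
by exists p => v; rewrite dotC -hp.
Qed.

(** With [w'] the image of [w] under the forward-backward map, this makes a weak cluster point a
    fixed point. *)
Lemma demiclosed (U : set_system nat) (x : nat -> H) (C : R) (w w' : H) :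
  ProperFilter U -> \oo `<=` U -> (forall n, `|x n| <= C) ->
  (forall v, dot (x n) v @[n --> U] --> dot w v) ->
  `|x n - x n.+1| @[n --> \oo] --> 0 ->
  (forall n, `|x n.+1 - w'| <= `|x n - w|) -> w' = w.
Proof.
move=> PU sU xC xw dx0 hx.
have dU : `|x n - x n.+1| @[n --> U] --> 0 by move=> A /dx0; exact: sU.
(* [r n] bounds [|w - w'|^2] from above: expand [|x n - w'|^2] around [w] and compare with the
   triangle inequality through [x n.+1]. *)
pose r := fun n => `|x n - x n.+1| * (`|x n - x n.+1| + 2 * (C + `|w|))
  - 2 * (dot (x n) (w - w') - dot w (w - w')).
have r0 : r n @[n --> U] --> 0.
  have -> : 0 = 0 * (0 + 2 * (C + `|w|)) - 2 * (dot w (w - w') - dot w (w - w')).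
    by rewrite subrr mul0r mulr0 subr0.
  apply: cvgB.
    by apply: cvgM => //; apply: cvgD => //; exact: cvg_cst.
  apply: cvgM; first exact: cvg_cst.
  by apply: cvgB => //; exact: cvg_cst.
have : `|w - w'| ^+ 2 <= 0.
  apply: (cvgr_to_ge r0); apply: filterE => n.
  have tri : `|x n - w'| <= `|x n - x n.+1| + `|x n - w|.
    have -> : x n - w' = (x n - x n.+1) + (x n.+1 - w') by rewrite addrA subrK.
    by rewrite (le_trans (ler_normD _ _))// lerD2l.
  have bd : `|x n - w| <= C + `|w|.
    by rewrite (le_trans (ler_normB _ _))// lerD2r.
  have sq : `|x n - w'| ^+ 2 <= (`|x n - x n.+1| + `|x n - w|) ^+ 2.
    by rewrite ler_pXn2r ?nnegrE ?addr_ge0.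
  have pr : `|x n - x n.+1| * `|x n - w| <= `|x n - x n.+1| * (C + `|w|).
    by rewrite ler_wpM2l.
  have : `|x n - w'| ^+ 2 =
      `|x n - w| ^+ 2 + 2 * (dot (x n) (w - w') - dot w (w - w')) + `|w - w'| ^+ 2.
    by rewrite !normE !dotE (dotC w (x n)) (dotC w' (x n)) (dotC w' w); lra.
  rewrite /r; lra.
move=> h; apply/eqP; rewrite eq_sym -subr_eq0 -normr_eq0 -sqrf_eq0.
by rewrite eq_le h sqr_ge0.
Qed.

Lemma opial (S : set H) (x : nat -> H) (C : R) : (forall n, `|x n| <= C) ->
  (forall p, S p -> nonincreasing_seq (fun n => `|x n - p|)) ->
  (forall U w, UltraFilter U -> \oo `<=` U ->
    (forall v, dot (x n) v @[n --> U] --> dot w v) -> S w) ->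
  exists2 w, S w & weakly_cvg dot x w.
Proof.
move=> xC mono cluster.
have [U0 [UU0 sU0]] := @ultraFilterLemma nat \oo _.
have [w hw] := ultra_weak_limit UU0 xC.
have Sw := cluster _ _ UU0 sU0 hw.
have cvg_dist p : S p -> cvg (`|x n - p| ^+ 2 @[n --> \oo]).
  move=> Sp; apply: nonincreasing_is_cvgn.
    by move=> m n mn; rewrite ler_pXn2r ?nnegrE//; exact: mono.
  by exists 0 => _ [n _ <-]; exact: sqr_ge0.
exists w => // v A Aw.
apply: (@mem_filter_of_ultra nat \oo ((fun n => dot (x n) v) @^-1` A)) => U UU sU.
have [w' hw'] := ultra_weak_limit UU xC.
have Sw' := cluster _ _ UU sU hw'.
suff ww : w = w' by move: Aw; rewrite ww; exact: hw'.
have /cvg_ex[a ha] := cvg_dist _ Sw; have /cvg_ex[b hb] := cvg_dist _ Sw'.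
pose c := 2^-1 * (b - a + (`|w| ^+ 2 - `|w'| ^+ 2)).
(* The difference of the two convergent squared distances determines the limit of
   [dot (x n) (w - w')]; both ultrafilters must give this value. *)
have hc : dot (x n) (w - w') @[n --> \oo] --> c.
  have -> : (fun n => dot (x n) (w - w')) = fun n =>
      2^-1 * (`|x n - w'| ^+ 2 - `|x n - w| ^+ 2 + (`|w| ^+ 2 - `|w'| ^+ 2)).
    by apply/funext => n; rewrite !normE !dotE (dotC w) (dotC w'); lra.
  apply: cvgM; first exact: cvg_cst.
  by apply: cvgD; [exact: cvgB|exact: cvg_cst].
have PU0 : ProperFilter U0 by apply: ultra_proper.
have PU : ProperFilter U by apply: ultra_proper.
have e0 : dot w (w - w') = c.
  by apply: (cvg_unique _ (hw _)) => // B /hc; exact: sU0.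
have e1 : dot w' (w - w') = c.
  by apply: (cvg_unique _ (hw' _)) => // B /hc; exact: sU.
apply/eqP; rewrite -subr_eq0 -(dot_eq0 normE) dotDl dotNl.
by rewrite e0 e1 subrr.
Qed.

End weak_limits.

(** * Resolvents and the forward-backward step *)

Section forward_backward.
Context (R : realType) (H : completeNormedModType R) (dot : {dot H for idfun}).
Context (normE : forall u : H, `|u| ^+ 2 = dot u u).
Let dotC := @dotC R H dot.
Let dotE := @dotE R H dot.

Lemma resolvent_firmly_nonexpansive f gam u v a b : 0 < gam ->
  subgradient dot f a (gam^-1 *: (u - a)) ->
  subgradient dot f b (gam^-1 *: (v - b)) ->
  `|a - b| ^+ 2 + `|(u - a) - (v - b)| ^+ 2 <= `|u - v| ^+ 2.
Proof.
move=> gam0 sa sb; have := subgradient_monotone sa sb.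
rewrite -scalerBr dotZr pmulr_rge0 ?invr_gt0// !normE !dotE.
rewrite (dotC b a) (dotC u a) (dotC u b) (dotC v a) (dotC v b) (dotC v u); lra.
Qed.

Lemma resolvent_nonexpansive f gam u v a b : 0 < gam ->
  subgradient dot f a (gam^-1 *: (u - a)) ->
  subgradient dot f b (gam^-1 *: (v - b)) -> `|a - b| <= `|u - v|.
Proof.
move=> gam0 sa sb; have h := resolvent_firmly_nonexpansive gam0 sa sb.
rewrite -(@ler_pXn2r _ 2) ?nnegrE//; apply: le_trans h.
by rewrite lerDl sqr_ge0.
Qed.

(** Firm nonexpansiveness and cocoercivity leave a surplus controlling [|u - a|^2]. The constant [k]
    precedes the points, so it serves all iterations. *)
Lemma forward_backward_decrease f gam l : 0 < gam < 2 / l -> 0 < l ->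
  exists2 k, 0 < k & forall p G G' u a,
    `|G - G'| ^+ 2 <= l * dot (u - p) (G - G') ->
    subgradient dot f p (- G') ->
    subgradient dot f a (gam^-1 *: (u - gam *: G - a)) ->
    `|a - p| ^+ 2 + k * `|u - a| ^+ 2 <= `|u - p| ^+ 2.
Proof.
move=> /andP[gam0 gaml] l0.
(* [K gam^2] is the surplus coefficient [gam (2 / l) - gam^2]. *)
pose K := (2 / l - gam) / gam.
have K0 : 0 < K by rewrite divr_gt0// subr_gt0.
have [k k0 [k1 kK]] : exists2 k, 0 < k & 2 * k <= 1 /\ 2 * k <= K.
  exists (Num.min 1 K / 2); first by rewrite divr_gt0// lt_min ltr01.
  by rewrite mulrC divfK// !ge_min !lexx orbT.
exists k => // p G G' u a co sp sa.
have sp' : subgradient dot f p (gam^-1 *: (p - gam *: G' - p)).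
  by rewrite addrAC subrr add0r scalerN scalerA mulVf ?gt_eqF// scale1r.
have := resolvent_firmly_nonexpansive gam0 sa sp'.
have {}co : gam * (2 / l) * `|G - G'| ^+ 2 <= 2 * gam * dot (u - p) (G - G').
  have -> : 2 * gam * dot (u - p) (G - G') = gam * (2 / l) * (l * dot (u - p) (G - G')).
    by field; rewrite gt_eqF.
  by rewrite ler_wpM2l// mulr_ge0// ?ltW// divr_gt0.
have -> : u - gam *: G - a - (p - gam *: G' - p) = (u - a) - gam *: (G - G').
  by rewrite [p - _ - p]addrAC subrr add0r opprK scalerBr opprB
    [u - _ - a]addrAC -[LHS]addrA (addrC (gam *: G')).
have -> : u - gam *: G - (p - gam *: G') = (u - p) - gam *: (G - G').
  by rewrite scalerBr !opprD !opprK !addrA; congr (_ + _); rewrite addrAC.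
move: (u - a) co => z; move: (G - G') (u - p) => w e co.
have gK : K * gam ^+ 2 = gam * (2 / l) - gam ^+ 2.
  by rewrite /K; field; rewrite !gt_eqF.
have par : `|z| ^+ 2 <= 2 * `|z - gam *: w| ^+ 2 + 2 * (gam ^+ 2 * `|w| ^+ 2).
  have := dot_ge0 normE (z - 2 *: (gam *: w)).
  by rewrite !normE !dotE (dotC w z); lra.
have : k * `|z| ^+ 2 <= k * (2 * `|z - gam *: w| ^+ 2 + 2 * (gam ^+ 2 * `|w| ^+ 2)).
  by rewrite ler_wpM2l// ltW.
have : 2 * k * `|z - gam *: w| ^+ 2 <= 1 * `|z - gam *: w| ^+ 2.
  by rewrite ler_wpM2r// sqr_ge0.
have : 2 * k * (gam ^+ 2 * `|w| ^+ 2) <= K * (gam ^+ 2 * `|w| ^+ 2).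
  by rewrite ler_wpM2r// mulr_ge0// sqr_ge0.
have : K * (gam ^+ 2 * `|w| ^+ 2) = gam * (2 / l) * `|w| ^+ 2 - gam ^+ 2 * `|w| ^+ 2.
  by rewrite mulrA gK mulrBl.
have : `|e - gam *: w| ^+ 2 = `|e| ^+ 2 - 2 * gam * dot e w + gam ^+ 2 * `|w| ^+ 2.
  by rewrite !normE !dotE (dotC w e); lra.
lra.
Qed.

End forward_backward.

(** * Convergence of the iteration and its linear rate *)

Theorem theorem5 (R : realType) (H : completeNormedModType R)
    (dot : {dot H for idfun}) (normE : forall u : H, `|u| ^+ 2 = dot u u)
    (psi : H -> \bar R) (phi : H -> R)
    (psi_proper : proper_function psi)
    (psi_lsc : lower_semicontinuous psi)
    (psi_convex : econvex_function psi)
    (phi_convex : convex_function [set: convex_lmodType H] phi)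
    (phi_gateaux : forall u : H, gateaux_differentiable phi u)
    (mu L : R -> H -> R)
    (mu_ge0 : forall (M : R) (u : H), 0 < M -> 0 <= mu M u)
    (mu_le_L : forall (M : R) (u : H), 0 < M -> mu M u <= L M u)
    (mu_L_bounds : forall (M : R) (u : H), 0 < M ->
       forall y z : H, ball u M y -> ball u M z ->
         mu M u * `|y - z| ^+ 2
           <= dot (y - z) (gradient dot phi y - gradient dot phi z)
           <= L M u * `|y - z| ^+ 2)
    (S : set H) (SE : S = argmin (fun u => (psi u + (phi u)%:E)%E))
    (S_neq0 : S !=set0)
    (x0 : H) (eps : R) (eps_gt0 : 0 < eps)
    (M0_finite : has_ubound [set `|xs - x0| | xs in S])
    (M0 : R) (M0E : M0 = sup [set `|xs - x0| | xs in S] + eps)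
    (LM0_finite : has_ubound [set L M0 xs | xs in S])
    (LM0 : R) (LM0E : LM0 = sup [set L M0 xs | xs in S])
    (LM0_gt0 : 0 < LM0)
    (gamma : R) (gamma_range : 0 < gamma < 2 / LM0)
    (x : nat -> H) (x_init : x 0%N = x0)
    (x_step : forall n : nat,
       x n.+1 = prox (fun u => (gamma%:E * psi u)%E)
                     (x n - gamma *: gradient dot phi (x n))) :
  (exists xs : H,
     [/\ S xs, (forall n : nat, ball xs M0 (x n)) & weakly_cvg dot x xs])
  /\
  (forall xs : H, S xs -> 0 < mu M0 xs ->
     let rho :=
       Num.max `|1 - gamma * mu M0 xs| `|1 - gamma * L M0 xs| in
     [/\ S = [set xs],
         forall n : nat, ball xs M0 (x n),
         forall n : nat, `|x n - xs| <= rho ^+ n * `|x0 - xs|,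
         0 <= rho < 1 &
         ~ (gamma * mu M0 xs = 1 /\ gamma * L M0 xs = 1) -> 0 < rho]).

have /andP[gamma0 _] := gamma_range.
have p_x0 p : S p -> `|p - x0| < M0.
  move=> Sp; rewrite M0E -[ltLHS]addr0 ler_ltD//.
  by apply: ub_le_sup => //; exists p.
have M0_gt0 : 0 < M0.
  by have [p /p_x0] := S_neq0; apply: le_lt_trans.
have L_le p : S p -> L M0 p <= LM0.
  by move=> Sp; rewrite LM0E; apply: ub_le_sup => //; exists p.
(* The constants 0 and [LM0] serve all minimizers at once. *)
have bounds p : S p -> forall y z, ball p M0 y -> ball p M0 z ->
    0 * `|y - z| ^+ 2
      <= dot (y - z) (gradient dot phi y - gradient dot phi z)
      <= LM0 * `|y - z| ^+ 2.
  move=> Sp y z yM zM; have /andP[h1 h2] := mu_L_bounds _ _ M0_gt0 _ _ yM zM.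
  apply/andP; split.
    by rewrite mul0r (le_trans _ h1)// mulr_ge0// mu_ge0.
  by rewrite (le_trans h2)// ler_wpM2r ?sqr_ge0// L_le.
have sub_S p : S p -> subgradient dot psi p (- gradient dot phi p).
  rewrite SE.
  exact: (minimizer_subgradient normE psi_proper psi_convex phi_gateaux mu_L_bounds).
have prox_sub u : subgradient dot psi (prox (fun y => (gamma%:E * psi y)%E) u)
    (gamma^-1 *: (u - prox (fun y => (gamma%:E * psi y)%E) u)).
  have [p /sub_S sp] := S_neq0.
  exact: (prox_subgradient normE psi_proper psi_lsc psi_convex u gamma0 sp).
have x_sub n : subgradient dot psi (x n.+1)
    (gamma^-1 *: (x n - gamma *: gradient dot phi (x n) - x n.+1)).
  by rewrite x_step; exact: prox_sub.
have [k k0 decrease] := forward_backward_decrease normE psi gamma_range LM0_gt0.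
have ball_decrease p n : S p -> ball p M0 (x n) ->
    `|x n.+1 - p| ^+ 2 + k * `|x n - x n.+1| ^+ 2 <= `|x n - p| ^+ 2.
  move=> Sp xM; apply: decrease (sub_S _ Sp) (x_sub n).
  have pM : ball p M0 p by exact: ballxx.
  have := gradient_bounds_combined normE phi_gateaux (ltW LM0_gt0) (bounds _ Sp) xM pM.
  by rewrite !mul0r addr0 add0r.
have step_le p n : S p -> ball p M0 (x n) -> `|x n.+1 - p| <= `|x n - p|.
  move=> Sp /(ball_decrease _ _ Sp) h.
  rewrite -(@ler_pXn2r _ 2) ?nnegrE//; apply: le_trans h.
  by rewrite lerDl mulr_ge0 ?sqr_ge0// ltW.
(* The decrease holds only inside the ball, but it keeps the next iterate there. *)
have x_ball p n : S p -> ball p M0 (x n).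
  move=> Sp; elim: n => [|n IH]; first by rewrite x_init -ball_normE /= p_x0.
  move: (IH); rewrite -ball_normE /= !(distrC p); apply: le_lt_trans.
  exact: step_le.
split.
  have mono p : S p -> nonincreasing_seq (fun n => `|x n - p|).
    by move=> Sp; apply/nonincreasing_seqP => n; apply: step_le => //; exact: x_ball.
  have [p0 Sp0] := S_neq0.
  have xC n : `|x n| <= M0 + `|p0|.
    have := x_ball p0 n Sp0; rewrite -ball_normE /= distrC => h.
    rewrite -[x n](subrK p0) (le_trans (ler_normD _ _))// lerD2r.
    exact: ltW.
  (* The squared distances to [p0] converge, and their successive differences dominate
     [k |x n - x n.+1|^2]. *)
  have dx0 : `|x n - x n.+1| @[n --> \oo] --> 0.
    have : cvg (`|x n - p0| ^+ 2 @[n --> \oo]).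
      apply: nonincreasing_is_cvgn.
        by move=> m n mn; rewrite ler_pXn2r ?nnegrE//; exact: mono.
      by exists 0 => _ [n _ <-]; exact: sqr_ge0.
    move=> /cvg_ex[a ha].
    have ha' : `|x n.+1 - p0| ^+ 2 @[n --> \oo] --> a.
      by have := cvg_shiftS (fun n => `|x n - p0| ^+ 2) (nbhs a) => ->.
    have hd : `|x n - p0| ^+ 2 - `|x n.+1 - p0| ^+ 2 @[n --> \oo] --> 0.
      by rewrite -(subrr a); exact: cvgB.
    apply/cvgr0Pnorm_lt => e e0.
    have : \forall n \near \oo,
        `|x n - p0| ^+ 2 - `|x n.+1 - p0| ^+ 2 < k * e ^+ 2.
      by apply: (cvgr_lt _ hd); rewrite mulr_gt0// exprn_gt0.
    apply: filterS => n hn; rewrite normr_id.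
    rewrite -(@ltr_pXn2r _ 2) ?nnegrE ?(ltW e0)// -(ltr_pM2l k0).
    by have := ball_decrease p0 n Sp0 (x_ball _ _ Sp0); lra.
  have [|w Sw xw] := opial normE xC mono.
    move=> U w UU sU xw.
    have PU : ProperFilter U by apply: ultra_proper.
    (* The forward step is nonexpansive only on the ball, so the weak limit must be located there:
       Cauchy-Schwarz gives [|w - p0| <= |x0 - p0| < M0]. *)
    have w_ball : ball p0 M0 w.
      rewrite -ball_normE /= distrC.
      have [->|wp0] := eqVneq w p0; first by rewrite subrr normr0.
      have {}wp0 : 0 < `|w - p0| by rewrite normr_gt0 subr_eq0.
      have lim_w : dot (x n) (w - p0) - dot p0 (w - p0) @[n --> U] --> `|w - p0| ^+ 2.
        by rewrite normE dotDl dotNl; apply: cvgB => //; exact: cvg_cst.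
      have : `|w - p0| ^+ 2 <= `|x0 - p0| * `|w - p0|.
        apply: (cvgr_to_le lim_w); apply: filterE => n.
        rewrite -dotNl -dotDl (le_trans (ler_norm _))//.
        rewrite (le_trans (cauchy_schwarz normE _ _))// ler_wpM2r//.
        by rewrite -x_init; exact: mono.
      rewrite expr2 ler_pM2r// => /le_lt_trans; apply.
      by rewrite distrC p_x0.
    have ww : prox (fun y => (gamma%:E * psi y)%E) (w - gamma *: gradient dot phi w) = w.
      apply: (demiclosed normE PU sU xC xw dx0) => n.
      apply: le_trans (resolvent_nonexpansive normE gamma0 (x_sub n) (prox_sub _)) _.
      have := forward_step_lipschitz normE phi_gateaux (ltW LM0_gt0) (bounds _ Sp0)
        (ltW gamma0) (x_ball _ n Sp0) w_ball.
      move=> /le_trans; apply.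
      rewrite -[leRHS]mul1r ler_wpM2r// ge_max mulr0 subr0 normr1 lexx /=.
      have /andP[_] := gamma_range; rewrite ltr_pdivlMr// => gl.
      have : 0 < gamma * LM0 by rewrite mulr_gt0.
      by rewrite ler_norml; lra.
    rewrite SE; apply: (subgradient_minimizer normE phi_gateaux mu_ge0 mu_L_bounds).
    have := prox_sub (w - gamma *: gradient dot phi w); rewrite ww.
    by rewrite [w - _ - w]addrAC subrr add0r scalerN scalerA mulVf ?gt_eqF// scale1r.
  by exists w; split => // n; exact: x_ball.
move=> p Sp mup rho.
have muL : mu M0 p <= L M0 p by exact: mu_le_L.
have rho_ge0 : 0 <= rho by rewrite le_max normr_ge0.
have gmu : 0 < gamma * mu M0 p by rewrite mulr_gt0.
have gmL : gamma * mu M0 p <= gamma * L M0 p by rewrite ler_pM2l.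
have gL : gamma * L M0 p < 2.
  have /andP[_] := gamma_range; rewrite ltr_pdivlMr//; apply: le_lt_trans.
  by rewrite ler_pM2l// L_le.
split.
- apply/seteqP; split => [q Sq|q ->//].
  apply: (minimizer_unique normE psi_proper psi_convex phi_gateaux mu_ge0
    mu_L_bounds _ _ M0_gt0 mup).
    by rewrite -SE.
  by rewrite -SE.
- by move=> n; exact: x_ball.
- elim=> [|n IH]; first by rewrite expr0 mul1r x_init.
  rewrite exprS -mulrA (le_trans _ (ler_wpM2l rho_ge0 IH))//.
  have sp' : subgradient dot psi p (gamma^-1 *: (p - gamma *: gradient dot phi p - p)).
    by rewrite addrAC subrr add0r scalerN scalerA mulVf ?gt_eqF// scale1r; exact: sub_S.
  (* The proximal step does not expand distances; the factor [rho] comes from the forward step. *)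
  apply: le_trans (resolvent_nonexpansive normE gamma0 (x_sub n) sp') _.
  apply: (forward_step_lipschitz normE phi_gateaux muL _ (ltW gamma0)
    (x_ball _ n Sp) (ballxx _ M0_gt0)).
  exact: mu_L_bounds.
- by rewrite rho_ge0 gt_max !ltr_norml; lra.
(* Both entries of the maximum vanish exactly when [gamma mu = gamma L = 1]. *)
- move=> nn; rewrite lt_max !normr_gt0 !subr_eq0 -negb_and.
  by apply/negP => /andP[/eqP e1 /eqP e2]; apply: nn.
Qed.
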